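(* Let $G$ be a locally compact group and let $\mathcal{H}$ be a uniformly recurrent subgroup (URS) of $G$. Then there exists a unique (up to $G$-equivariant homeomorphism) compact minimal $G$-space $M(G, \mathcal{H})$ which is subordinate to $\mathcal{H}$ and is universal among minimal compact $G$-spaces that are subordinate to $\mathcal{H}$.
   Context: Locally compact groups and compact spaces are assumed Hausdorff. $\operatorname{Sub}(G)$ is the set of closed subgroups of $G$ with the Chabauty topology, which has as subbasis of open sets the sets $\{H : H \cap C = \varnothing\}$ with $C \subseteq G$ compact, and $\{H : H \cap V \neq \varnothing\}$ with $V \subseteq G$ open; $G$ acts on it continuously by conjugation. A URS of $G$ is a nonempty closed, conjugation-invariant, minimal subset of $\operatorname{Sub}(G)$ (minimal: every orbit in it is dense in it). A compact $G$-space is a compact space with a continuous action of $G$; it is minimal if it is nonempty and every orbit is dense. A compact $G$-space $X$ is subordinate to $\mathcal{H}$ if every subgroup $H \in \mathcal{H}$ fixes a point of $X$. A member $X$ of a class of compact $G$-spaces is universal for the class if for every $Y$ in the class there is a continuous surjective $G$-equivariant map $X \to Y$. *)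

(* Defs.v *)
From HB Require Import structures.
From mathcomp Require Import all_boot.
From mathcomp Require Import all_classical.
From mathcomp Require Import topology.

Set Implicit Arguments.
Unset Strict Implicit.
Unset Printing Implicit Defensive.

Local Open Scope classical_set_scope.
Local Open Scope group_scope.

HB.mixin Record isTopologicalGroup G & Topological G & Group G := {
  mulg_continuous : continuous (fun p : G * G => p.1 * p.2) ;
  invg_continuous : continuous (fun x : G => x^-1)
}.

#[short(type="topologicalGroupType")]
HB.structure Definition TopologicalGroup :=
  {G of Topological G & Group G & isTopologicalGroup G}.

HB.mixin Record isGSpace (G : topologicalGroupType) X & Topological X := {
  gact : G -> X -> X ;
  gact1 : forall x, gact 1 x = x ;
  gactM : forall g h x, gact (g * h) x = gact g (gact h x) ;
  gact_continuous : continuous (fun p : G * X => gact p.1 p.2)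
}.

#[short(type="gSpaceType")]
HB.structure Definition GSpace (G : topologicalGroupType) :=
  {X of Topological X & isGSpace G X}.

Section ClosedSubgroups.
Variable G : topologicalGroupType.

Record closed_subgroup := ClosedSubgroup {
  csg_set :> set G ;
  csg_closed : closed csg_set ;
  csg_group : group_closed [pred x | x \in csg_set]
}.

HB.instance Definition _ := gen_eqMixin closed_subgroup.
HB.instance Definition _ := gen_choiceMixin closed_subgroup.

Definition chabauty_subbase : set (set closed_subgroup) :=
  [set [set H : closed_subgroup | H `&` C = set0] | C in @compact G] `|`
  [set [set H : closed_subgroup | H `&` V !=set0] | V in @open G].

HB.instance Definition _ :=
  isSubBaseTopological.Build closed_subgroup chabauty_subbase id.

Section Conjugation.
Variables (g : G) (H : closed_subgroup).

(* In MathComp x ^ y is y^-1 * x * y, so this is g H g^-1. *)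
Definition csg_conj_set : set G := [set h ^ g^-1 | h in H].

Lemma csg_conj_setE : csg_conj_set = (fun x => x ^ g) @^-1` H.
Proof.
apply/seteqP; split => [_ [h Hh <-]|x Hx] /=; first by rewrite conjgKV.
by exists (x ^ g) => //; rewrite conjgK.
Qed.

Lemma csg_conj_closed : closed csg_conj_set.
Proof.
rewrite csg_conj_setE; apply: preimage_closed; last exact: csg_closed.
move=> x _.
have mulc (a : G) (f : G -> G) : {for x, continuous f} ->
    {for x, continuous (fun y => a * f y)}.
  move=> cf; apply: (@continuous_comp _ _ _ (fun y => (a, f y))
    (fun p : G * G => p.1 * p.2)); last exact: mulg_continuous.
  by apply: cvg_pair => /=; [exact: cvg_cst|exact: cf].
have mulr (a : G) (f : G -> G) : {for x, continuous f} ->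
    {for x, continuous (fun y => f y * a)}.
  move=> cf; apply: (@continuous_comp _ _ _ (fun y => (f y, a))
    (fun p : G * G => p.1 * p.2)); last exact: mulg_continuous.
  by apply: cvg_pair => /=; [exact: cf|exact: cvg_cst].
by apply: mulc; apply: mulr; exact: cvg_id.
Qed.

Lemma csg_conj_group : group_closed [pred x | x \in csg_conj_set].
Proof.
have [H1 HF] := csg_group H.
have E x : (x \in csg_conj_set) = (x ^ g \in csg_set H).
  by rewrite csg_conj_setE; apply/idP/idP; rewrite !in_setE.
split=> [|x y]; rewrite -!topredE /= !E; first by rewrite conj1g.
by move=> Hx Hy; rewrite conjMg conjVg; exact: HF.
Qed.

Definition csg_conj : closed_subgroup :=
  ClosedSubgroup csg_conj_closed csg_conj_group.

End Conjugation.

Record URS (HH : set closed_subgroup) : Prop := {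
  urs_neq0 : HH !=set0 ;
  urs_closed : closed HH ;
  urs_conj : forall g H, HH H -> HH (csg_conj g H) ;
  urs_minimal : forall H, HH H ->
    HH `<=` closure (range (fun g => csg_conj g H))
}.

End ClosedSubgroups.

Section GSpaces.
Variable G : topologicalGroupType.

Definition compact_gspace (X : gSpaceType G) :=
  hausdorff_space X /\ compact [set: X].

Definition gorbit (X : gSpaceType G) (x : X) : set X :=
  range (fun g : G => gact g x).

Definition minimal_gspace (X : gSpaceType G) :=
  [set: X] !=set0 /\ forall x : X, dense (gorbit x).

Definition subordinate (HH : set (closed_subgroup G)) (X : gSpaceType G) :=
  forall H, HH H -> exists x : X, forall h, csg_set H h -> gact h x = x.

Definition equivariant (X Y : gSpaceType G) (f : X -> Y) :=
  forall (g : G) (x : X), f (gact g x) = gact g (f x).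

Definition minimal_subordinate (HH : set (closed_subgroup G))
    (X : gSpaceType G) :=
  [/\ compact_gspace X, minimal_gspace X & subordinate HH X].

Definition universal (C : gSpaceType G -> Prop) (X : gSpaceType G) :=
  C X /\ forall Y, C Y -> exists f : X -> Y,
    [/\ continuous f, set_surj [set: X] [set: Y] f & equivariant f].

Definition gspace_iso (X Y : gSpaceType G) :=
  exists (f : X -> Y) (f' : Y -> X),
    [/\ continuous f, continuous f', cancel f f', cancel f' f & equivariant f].

End GSpaces.

(* Main.v *)
(** Fix K in the URS. Let A be the greatest ambit of G with a K-fixed base point
    e: a compact G-space in which the orbit of e is dense and which maps to every
    compact G-space X by a morphism taking e to any prescribed K-fixed point of X.
    Let M be a minimal closed invariant subset of A. By compactness of the URS,
    every point of A is fixed by some member of the URS, so M has a point fixed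
    by a member of the URS, and by minimality of the URS every member fixes a
    point of M. Universality of M is inherited from A. For uniqueness, the
    K-fixed points of M form a compact right topological semigroup; idempotents
    (Ellis-Numakura) show that every endomorphism of M has a right inverse, hence
    is invertible. If M' is also universal, M -> M' -> M is therefore invertible. *)

Require Import Defs.
From HB Require Import structures.
From mathcomp Require Import all_boot all_classical topology.

Set Implicit Arguments.
Unset Strict Implicit.
Unset Printing Implicit Defensive.

Local Open Scope classical_set_scope.
Local Open Scope group_scope.

(** * Minimal closed sets and projections along compact factors *)

Lemma compact_minimal (X : topologicalType) (P : set (set X)) (A : set X) :
  compact A -> A !=set0 -> P A -> P `<=` @closed X ->
  (forall D : set (set X), D !=set0 -> D `<=` P -> P (\bigcap_(B in D) B)) ->
  exists M, [/\ P M, M !=set0, M `<=` A &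
    forall N, P N -> N !=set0 -> N `<=` M -> M `<=` N].
Proof.
move=> cA A0 PA Pcl Pcap.
pose Q := [set B | [/\ P B, B !=set0 & B `<=` A]].
pose R (B C : {B | Q B}) := `[< sval C `<=` sval B >].
have QA : Q A by split.
have [||D totD|[M [PM M0 MA]] Mmax] := @ZL_preorder _ (exist Q A QA) R.
- by move=> B; apply/asboolP.
- by move=> C B D /asboolP CB /asboolP DC; apply/asboolP => x /DC/CB.
- have [->|/set0P [B0 DB0]] := eqVneq D set0.
    by exists (exist Q A QA).
  pose D' := [set sval B | B in D].
  have D'P : D' `<=` P by move=> _ [B _ <-]; case: (svalP B).
  have D'0 : D' !=set0 by exists (sval B0), B0.
  (* The chain generates a proper filter. Its cluster point in [A] lies in every member, as these
     are closed, so the intersection is nonempty and bounds the chain for Zorn's lemma. *)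
  have FF : ProperFilter (filter_from D' id).
    apply: filter_from_proper; last by move=> _ [B _ <-]; case: (svalP B).
    apply: filter_from_filter => // _ _ [B DB <-] [C DC <-].
    have [/asboolP BC|/asboolP CB] := totD B C DB DC.
      by exists (sval C); [exists C|move=> x Cx; split => //; exact: BC].
    by exists (sval B); [exists B|move=> x Bx; split => //; exact: CB].
  have [|p [Ap clp]] := cA _ FF.
    by exists (sval B0); [exists B0|case: (svalP B0)].
  have QI : Q (\bigcap_(B in D') B).
    split; first exact: Pcap.
      exists p => B D'B; apply: (Pcl _ (D'P _ D'B)) => V pV.
      by apply: clp => //; exists B.
    move=> x /(_ (sval B0)) B0x; case: (svalP B0) => _ _; apply.
    by apply: B0x; exists B0.
  exists (exist Q _ QI) => B DB; apply/asboolP => x /=; apply.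
  by exists B.
- exists M; split=> // N PN N0 NM.
  have QN : Q N by split=> // x /NM/MA.
  by have /asboolP := Mmax (exist Q N QN) (asboolT NM).
Qed.

(** The tube lemma: if no (x, y) with y in [K] lies in [E], compactness gives one neighbourhood of x
    that works for all y in [K]. *)
Lemma closed_proj (X Y : topologicalType) (E : set (X * Y)) (K : set Y) :
  closed E -> compact K -> closed [set x | exists2 y, K y & E (x, y)].
Proof.
move=> clE /compact_near_coveringP cK; rewrite -openC openE => x /= nEx.
pose nE x' y' := ~ E (x', y').
have /(cK _ _ nE) : forall y, K y ->
    \forall y' \near y & x' \near x, nE x' y'.
  move=> y Ky.
  have oE : nbhs (x, y) (~` E).
    apply: open_nbhs_nbhs; split; first exact: closed_openC.
    by move=> Exy; apply: nEx; exists y.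
  case: oE => -[U V] /= [Ux Vy] UVE; exists (V, U) => // -[y' x'] [/= Vy' Ux'].
  exact: (UVE (x', y')).
by apply: filterS => x' KE [y /KE].
Qed.

(** * Invariant sets, minimality and equivariant maps *)

Section GSpaceTheory.
Variable G : topologicalGroupType.
Implicit Types X Y : gSpaceType G.

Lemma gact_continuousr X (g : G) : continuous (@gact G X g).
Proof.
move=> x; exact: (cvg_comp2 (cvg_cst g) cvg_id (@gact_continuous G X (g, x))).
Qed.

Lemma gactK X (g : G) : cancel (@gact G X g) (gact g^-1).
Proof. by move=> x; rewrite -gactM mulVg gact1. Qed.

Definition ginvariant X (A : set X) := forall (g : G) x, A x -> A (gact g x).

Lemma invariant_gorbit X (x : X) : ginvariant (gorbit x).
Proof. by move=> g _ [h _ <-]; exists (g * h) => //; rewrite gactM. Qed.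

Lemma invariant_closure X (A : set X) : ginvariant A -> ginvariant (closure A).
Proof.
move=> iA g x clx B /(@gact_continuousr _ g x) /clx [y [Ay By]].
by exists (gact g y); split => //; exact: iA.
Qed.

Lemma dense_closed (T : topologicalType) (S C : set T) :
  dense S -> closed C -> S `<=` C -> C = setT.
Proof.
move=> dS cC SC; apply/seteqP; split=> // x _; apply: contrapT => nCx.
by have [||y [nCy /SC]] := dS (~` C); [exists x|exact: closed_openC|].
Qed.

Lemma minimal_closed_invariant X (C : set X) : minimal_gspace X ->
  closed C -> ginvariant C -> C !=set0 -> C = setT.
Proof.
move=> [_ dX] cC iC [x Cx]; apply: (dense_closed (dX x)) => //.
by move=> _ [g _ <-]; exact: iC.
Qed.

Lemma minimal_gspaceP X : [set: X] !=set0 ->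
  (forall C : set X, closed C -> ginvariant C -> C !=set0 -> C = setT) ->
  minimal_gspace X.
Proof.
move=> X0 CT; split=> // x O [y Oy] oO; apply: contrapT => nOx.
have clT : closure (gorbit x) = setT.
  apply: CT; first exact: closed_closure.
    exact/invariant_closure/invariant_gorbit.
  by exists (gact 1 x); apply: subset_closure; exists 1.
have : closure (gorbit x) y by rewrite clT.
move=> /(_ O) []; first exact: open_nbhs_nbhs.
by move=> z [xz Oz]; apply: nOx; exists z.
Qed.

Lemma closed_equalizer (T U : topologicalType) (f f' : T -> U) :
  hausdorff_space U -> continuous f -> continuous f' ->
  closed [set x | f x = f' x].
Proof.
move=> hU cf cf' z clz; apply: hU => A B fA fB.
have fAB : nbhs z ((f @^-1` A) `&` (f' @^-1` B)).
  by apply: filterI; [exact: cf fA|exact: cf' fB].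
have [w [/= ffw [Aw Bw]]] := clz _ fAB.
by exists (f w); split => //; rewrite ffw.
Qed.

(** The equalizer is closed and contains the dense orbit of [x]. *)
Lemma equivariant_ext X Y (f f' : X -> Y) (x : X) : hausdorff_space Y ->
  dense (gorbit x) -> continuous f -> continuous f' ->
  equivariant f -> equivariant f' -> f x = f' x -> f = f'.
Proof.
move=> hY dx cf cf' ef ef' fx; apply: funext => y.
suff : [set y | f y = f' y] = setT by move=> /seteqP [_]; apply.
apply: dense_closed dx _ _; first exact: closed_equalizer.
by move=> _ [g _ <-] /=; rewrite ef ef' fx.
Qed.

Lemma invariant_image X Y (f : X -> Y) (A : set X) :
  equivariant f -> ginvariant A -> ginvariant (f @` A).
Proof.
by move=> ef iA g _ [x Ax <-]; exists (gact g x); rewrite ?ef//; exact: iA.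
Qed.

Lemma compact_gspace_image_closed X Y (f : X -> Y) (A : set X) :
  compact_gspace X -> compact_gspace Y -> continuous f -> closed A ->
  closed (f @` A).
Proof.
move=> [hX cX] [hY _] cf cA; apply: compact_closed => //.
apply: continuous_compact; last exact: subclosed_compact cA cX _.
exact: continuous_subspaceT.
Qed.

Lemma equivariant_surj X Y (f : X -> Y) : compact_gspace X ->
  [set: X] !=set0 -> compact_gspace Y -> minimal_gspace Y ->
  continuous f -> equivariant f -> set_surj [set: X] [set: Y] f.
Proof.
move=> cX [x _] cY mY cf ef.
suff -> : [set: Y] = range f by exact: subset_refl.
apply/esym/minimal_closed_invariant => //.
- exact: compact_gspace_image_closed cf closedT.
- exact: invariant_image.
- by exists (f x), x.
Qed.

End GSpaceTheory.

(** * Initial topologies for families of equivariant maps *)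

Section InitialGSpace.
Variables (G : topologicalGroupType) (T : Type) (act : G -> T -> T).
Variable Fam : forall Y : gSpaceType G, set (T -> Y).
Hypothesis Fam_equivariant :
  forall Y f, @Fam Y f -> forall g t, f (act g t) = gact g (f t).
Hypothesis Fam_separating :
  forall s t, (forall Y f, @Fam Y f -> f s = f t) -> s = t.

(* The hypotheses are parameters of the type so that the instances below can be
   inferred from it. *)
Definition initial_gspace : Type :=
  let _ := (Fam_equivariant, Fam_separating) in T.

HB.instance Definition _ := gen_eqMixin initial_gspace.
HB.instance Definition _ := gen_choiceMixin initial_gspace.

(* A set is open when it belongs to every filter that converges to one of its
   points along all maps of the family. *)
Definition initial_open : set_system initial_gspace :=
  [set O | forall t (F : set_system T), O t -> Filter F ->
     (forall Y f, @Fam Y f -> f @ F --> f t) -> F O].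

Let initial_openT : initial_open setT.
Proof. by move=> t F _ FF _; exact: filterT. Qed.

Let initial_openI : setI_closed initial_open.
Proof.
move=> A B oA oB t F [At Bt] FF cF.
by apply: filterI; [exact: oA At FF cF|exact: oB Bt FF cF].
Qed.

Let initial_open_bigU (I : Type) (f : I -> set initial_gspace) :
  (forall i, initial_open (f i)) -> initial_open (\bigcup_i f i).
Proof.
move=> oA t F [i _ Ait] FF cF.
by apply: filterS (oA i t F Ait FF cF); exact: bigcup_sup.
Qed.

HB.instance Definition _ := isOpenTopological.Build initial_gspace
  initial_openT initial_openI initial_open_bigU.

Let open_initial (O : set initial_gspace) : open O = initial_open O.
Proof. by []. Qed.

Lemma initial_gspace_cvg (F : set_system initial_gspace) (x : initial_gspace) :
  Filter F -> (forall Y f, @Fam Y f -> f @ F --> f x) -> F --> x.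
Proof.
move=> FF cF A; rewrite nbhsE => -[O []]; rewrite open_initial => oO Ox OA.
by apply: filterS OA _; exact: oO Ox FF cF.
Qed.

Lemma initial_gspace_continuous (Y : gSpaceType G) (f : initial_gspace -> Y) :
  @Fam Y f -> continuous f.
Proof.
move=> Ff; apply/continuousP => U oU; rewrite open_initial => t F Ut FF cF.
by apply: (cF _ _ Ff); exact: open_nbhs_nbhs.
Qed.

Let initial_act : G -> initial_gspace -> initial_gspace := act.

Let initial_act1 x : initial_act 1 x = x.
Proof.
by apply: Fam_separating => Y f Ff; rewrite (Fam_equivariant Ff) gact1.
Qed.

Let initial_actM g h x :
  initial_act (g * h) x = initial_act g (initial_act h x).
Proof.
by apply: Fam_separating => Y f Ff; rewrite !(Fam_equivariant Ff) gactM.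
Qed.

(** Convergence is tested after each map of the family, where equivariance reduces the claim to the
    action on [Y]. *)
Let initial_act_continuous :
  continuous (fun p : G * initial_gspace => initial_act p.1 p.2).
Proof.
move=> [g x]; apply: initial_gspace_cvg => Y f Ff.
have fE : f \o (fun p : G * initial_gspace => initial_act p.1 p.2) =
    fun p : G * initial_gspace => gact p.1 (f p.2).
  by apply: funext => p; exact: Fam_equivariant.
rewrite -fmap_comp fE (Fam_equivariant Ff).
have cf : (fun p : G * initial_gspace => f p.2) @ (g, x) --> f x.
  have := @initial_gspace_continuous _ _ Ff x.
  exact: (cvg_comp _ _ (@cvg_snd _ _ (nbhs g) (nbhs x) _)).
exact: (cvg_comp2 cvg_fst cf (@gact_continuous G Y (g, f x))).
Qed.

HB.instance Definition _ := isGSpace.Build G initial_gspace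
  initial_act1 initial_actM initial_act_continuous.

Lemma initial_gspace_hausdorff :
  (forall Y f, @Fam Y f -> hausdorff_space Y) -> hausdorff_space initial_gspace.
Proof.
move=> FamH x y cxy; apply: Fam_separating => Y f Ff.
apply: (FamH _ _ Ff) => A B fA fB.
have [z [Az Bz]] := cxy _ _ (initial_gspace_continuous Ff fA)
  (initial_gspace_continuous Ff fB).
by exists (f z).
Qed.

End InitialGSpace.

(** * The greatest ambit with a fixed base point *)

Lemma ultra_fmap (T U : Type) (f : T -> U) (F : set_system T) :
  UltraFilter F -> UltraFilter (f @ F).
Proof.
move=> UF; split=> [|K PK FK]; first exact: fmap_proper_filter.
apply/seteqP; split=> // A KA.
have [//|FnA] := in_ultra_setVsetC (f @^-1` A) UF.
have K0 : K set0 by rewrite -(setICr A); apply: filterI => //; exact: FK.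
by case: (@filter_not_empty _ _ PK K0).
Qed.

Lemma compact_ultra_cvg (X : topologicalType) (A : set X) (F : set_system X) :
  compact A -> UltraFilter F -> F A -> exists2 x, A x & F --> x.
Proof. by rewrite compact_ultra => cA UF /cA [x [Ax Fx]]; exists x. Qed.

(** The subtype gets the initial topology for the restrictions of equivariant maps on [X], among
    them the inclusion. An ultrafilter whose image converges in [A] therefore converges in the
    subtype. *)
Lemma sub_gspace (G : topologicalGroupType) (X : gSpaceType G) (A : set X) :
  compact_gspace X -> closed A -> ginvariant A ->
  exists (Y : gSpaceType G) (i : Y -> X),
    [/\ compact_gspace Y, continuous i, equivariant i, injective i &
        range i = A].
Proof.
move=> [hX cX] clA iA.
pose act g (t : {x | A x}) : {x | A x} :=
  exist _ (gact g (sval t)) (iA g _ (svalP t)).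
pose Fam (Y : gSpaceType G) : set ({x | A x} -> Y) := [set f |
  exists h : X -> Y,
    [/\ hausdorff_space Y, continuous h, equivariant h & f = h \o sval]].
have FamE Y f : Fam Y f -> forall g t, f (act g t) = gact g (f t).
  by move=> [h [_ _ eh ->]] g t /=; rewrite eh.
have Fam_sval : Fam X sval by exists id; split=> // x; exact: cvg_id.
have sval_inj : injective (sval : {x | A x} -> X).
  by move=> [x Ax] [y Ay] /= xy; subst y; congr exist; exact: Prop_irrelevance.
have Famsep s t : (forall Y f, Fam Y f -> f s = f t) -> s = t.
  by move=> /(_ _ _ Fam_sval)/sval_inj.
have csval := initial_gspace_continuous (Fam_equivariant := FamE)
  (Fam_separating := Famsep) Fam_sval.
exists (initial_gspace FamE Famsep), sval; split=> //.
- split; first by apply: initial_gspace_hausdorff => Y f [h []].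
  rewrite compact_ultra => F UF _.
  have [|x Ax Fx] := compact_ultra_cvg (subclosed_compact clA cX (@subsetT _ A))
    (ultra_fmap sval UF).
    apply: (@filterS _ F _ setT); last exact: filterT.
    by move=> t _; exact: svalP.
  exists (exist _ x Ax); split=> //.
  apply: initial_gspace_cvg => Y _ [h [_ ch _ ->]].
  exact: cvg_comp Fx (ch x).
- by apply/seteqP; split=> [_ [[x Ax] _ <-]|x Ax] //; exists (exist _ x Ax).
Qed.

Section Ambit.
Variables (G : topologicalGroupType) (H : set G).

Definition fixed_by (X : gSpaceType G) (x : X) :=
  forall h, H h -> gact h x = x.

Definition orbit_cvg (X : gSpaceType G) (x : X) (F : set_system G) (z : X) :=
  (fun g => gact g x) @ F --> z.

(* Quantifying over all compact G-spaces inside Prop keeps these filters, and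
   hence the ambit, in the universe of G: no set of representatives is needed. *)
Definition ambit_filter (F : set_system G) := ProperFilter F /\
  forall (X : gSpaceType G) (x : X), compact_gspace X -> fixed_by x ->
    exists z, orbit_cvg x F z.

(** Filters with the same limits must be identified for the ambit to be Hausdorff. *)
Definition ambit_equiv (F F' : set_system G) :=
  forall (X : gSpaceType G) (x : X), compact_gspace X -> fixed_by x ->
    orbit_cvg x F = orbit_cvg x F'.

(* A chosen representative of each class, so that points are filters rather than
   classes of filters. *)
Definition ambit_repr (F : set_system G) : set_system G :=
  xget setT [set F' | ambit_filter F' /\ ambit_equiv F F'].

(** [F] itself is a candidate, so the default [setT] of [xget] does not occur here. *)
Lemma ambit_reprP F : ambit_filter F ->
  ambit_filter (ambit_repr F) /\ ambit_equiv F (ambit_repr F).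
Proof.
move=> aF; suff : [set F' | ambit_filter F' /\ ambit_equiv F F'] (ambit_repr F).
  by [].
by apply: (@xgetI _ _ _ F); split.
Qed.

Lemma ambit_repr_eq F F' : ambit_equiv F F' -> ambit_repr F = ambit_repr F'.
Proof.
move=> FF'; congr xget; apply/seteqP; split=> K [aK FK]; split=> // X x cX Hx.
  by rewrite -(FF' X x)// FK.
by rewrite (FF' X x)// FK.
Qed.

Definition ambit_point := {F | ambit_filter F /\ ambit_repr F = F}.

Lemma ambit_pointP F : ambit_filter F ->
  ambit_filter (ambit_repr F) /\ ambit_repr (ambit_repr F) = ambit_repr F.
Proof.
move=> /ambit_reprP[aF eF]; split=> //.
by apply: ambit_repr_eq => X x cX Hx; rewrite -eF.
Qed.

Definition ambit_class F (aF : ambit_filter F) : ambit_point :=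
  exist _ (ambit_repr F) (ambit_pointP aF).

Lemma ambit_translate g F :
  ambit_filter F -> ambit_filter ((fun h => g * h) @ F).
Proof.
move=> [PF cF]; split; first exact: fmap_proper_filter.
move=> X x cX Hx; have [z Fz] := cF X x cX Hx; exists (gact g z).
rewrite /orbit_cvg -fmap_comp.
have -> : (fun h => gact h x) \o (fun h => g * h) =
    gact g \o (fun h => gact h x).
  by apply: funext => h; exact: gactM.
exact: (cvg_comp _ _ Fz (@gact_continuousr G X g z)).
Qed.

Definition ambit_act g (t : ambit_point) : ambit_point :=
  ambit_class (ambit_translate g (svalP t).1).

(** These maps extend the orbit map of a fixed point [x]: [f t] is the limit of g x as g runs along
    the filter [t]. *)
Definition ambit_family (X : gSpaceType G) : set (ambit_point -> X) :=
  [set f | exists x, [/\ compact_gspace X, fixed_by x &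
     forall t, orbit_cvg x (sval t) (f t)]].

Lemma orbit_cvg_unique (X : gSpaceType G) (x : X) (F : set_system G) z z' :
  hausdorff_space X -> ProperFilter F ->
  orbit_cvg x F z -> orbit_cvg x F z' -> z = z'.
Proof. by move=> hX PF; exact: cvg_unique. Qed.

Lemma ambit_class_cvg (X : gSpaceType G) (x : X) F (aF : ambit_filter F) :
  compact_gspace X -> fixed_by x ->
  orbit_cvg x (sval (ambit_class aF)) = orbit_cvg x F.
Proof. by move=> cX Hx; rewrite -(ambit_reprP aF).2. Qed.

Lemma ambit_family_ex (X : gSpaceType G) (x : X) :
  compact_gspace X -> fixed_by x ->
  exists f : ambit_point -> X, forall t, orbit_cvg x (sval t) (f t).
Proof.
move=> cX Hx.
suff /choice[f ft] :
    forall t : ambit_point, exists z, orbit_cvg x (sval t) z.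
  by exists f.
by move=> t; have [[_ cF] _] := svalP t; exact: cF.
Qed.

Lemma ambit_family_equivariant (X : gSpaceType G) (f : ambit_point -> X) :
  ambit_family f -> forall g t, f (ambit_act g t) = gact g (f t).
Proof.
move=> [x [cX Hx ft]] g t; have := ft (ambit_act g t).
rewrite (ambit_class_cvg (ambit_translate g (svalP t).1) cX Hx) => tx.
have [[PF _] _] := svalP t; have [hX _] := cX.
apply: (orbit_cvg_unique hX _ tx).
rewrite /orbit_cvg -fmap_comp.
have -> : (fun h => gact h x) \o (fun h => g * h) =
    gact g \o (fun h => gact h x).
  by apply: funext => h; exact: gactM.
exact: (cvg_comp _ _ (ft t) (@gact_continuousr G X g (f t))).
Qed.

(** The values of the maps determine all limits, so [s] and [t] are equivalent filters; as chosen
    representatives they coincide. *)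
Lemma ambit_family_separating s t :
  (forall (X : gSpaceType G) (f : ambit_point -> X),
     ambit_family f -> f s = f t) ->
  s = t.
Proof.
have cvgE (X : gSpaceType G) (x : X) (f : ambit_point -> X) u :
    compact_gspace X -> (forall t, orbit_cvg x (sval t) (f t)) ->
    orbit_cvg x (sval u) = [set f u].
  move=> [hX _] ft; apply/seteqP; split=> [z uz|_ ->]; last exact: ft.
  have [[PF _] _] := svalP u.
  exact: orbit_cvg_unique hX PF uz (ft u).
move=> st; have st' : sval s = sval t.
  rewrite -(svalP s).2 -(svalP t).2; apply: ambit_repr_eq => X x cX Hx.
  have [f ft] := ambit_family_ex cX Hx.
  by rewrite (cvgE X x f s)// (cvgE X x f t)// (st X f)//; exists x.
move: s t st' {st} => [F aF] [F' aF'] /= FF'; subst F'.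
by congr exist; exact: Prop_irrelevance.
Qed.

Definition ambit := initial_gspace ambit_family_equivariant
  ambit_family_separating.

HB.instance Definition _ := GSpace.on ambit.

Lemma ambit_hausdorff : hausdorff_space ambit.
Proof. by apply: initial_gspace_hausdorff => X f [x [[]]]. Qed.

(* The limit of an ultrafilter U of points is the class of the filter of the
   sets S that belong to U-almost every point. *)
Lemma ambit_compact : compact [set: ambit].
Proof.
rewrite compact_ultra => U UU _.
pose F : set_system G := [set S | U [set t : ambit | sval t S]].
have FE S : F S = U [set t | sval t S] by [].
have PF : ProperFilter F.
  split; last split.
  - rewrite FE => /filter_ex [t] /= t0; have [[Pt _] _] := svalP t.
    exact: (@filter_not_empty _ _ Pt).
  - rewrite FE; apply: filterE => t; have [[Pt _] _] := svalP t.
    exact: filterT.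
  - move=> A B; rewrite !FE => FA FB; apply: filterS (filterI FA FB).
    by move=> t [tA tB]; have [[Pt _] _] := svalP t; exact: filterI.
  - move=> A B AB; rewrite !FE; apply: filterS => t /= tA.
    by have [[Pt _] _] := svalP t; exact: filterS tA.
have Fcvg (X : gSpaceType G) (x : X) (f : ambit_point -> X) z :
    (forall t, orbit_cvg x (sval t) (f t)) -> f @ U --> z -> orbit_cvg x F z.
  (* If [f t] lies in the interior of [V], then [V] is a neighbourhood of [f t], as the convergence
     [ft] requires. *)
  move=> ft Uz V /nbhs_interior/Uz fV.
  apply: (@filterS _ U _ (f @^-1` V^°)) => // t; exact: ft.
have aF : ambit_filter F.
  split=> // X x cX Hx; have [f ft] := ambit_family_ex cX Hx.
  have [|z _ Uz] := compact_ultra_cvg cX.2 (ultra_fmap f UU).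
    exact: filterT.
  by exists z; exact: Fcvg ft Uz.
exists (ambit_class aF); split=> //; apply: initial_gspace_cvg => X f.
move=> [x [cX Hx ft]].
have [|z _ Uz] := compact_ultra_cvg cX.2 (ultra_fmap f UU).
  exact: filterT.
suff -> : f (ambit_class aF) = z by [].
apply: (orbit_cvg_unique cX.1 PF _ (Fcvg X x f z ft Uz)).
by rewrite -(ambit_class_cvg aF cX Hx).
Qed.

Lemma ambit_unit_filter : ambit_filter (principal_filter (1 : G)).
Proof.
split; first exact: principal_filter_proper.
move=> X x cX Hx; exists x => V /nbhs_singleton Vx.
by apply/principal_filterP; rewrite /= gact1.
Qed.

Definition ambit_unit : ambit := ambit_class ambit_unit_filter.

Lemma ambit_family_unit (X : gSpaceType G) (x : X) (f : ambit -> X) :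
  compact_gspace X -> fixed_by x -> (forall t, orbit_cvg x (sval t) (f t)) ->
  f ambit_unit = x.
Proof.
move=> cX Hx ft; have := ft ambit_unit.
rewrite (ambit_class_cvg ambit_unit_filter cX Hx) => fx.
apply: (orbit_cvg_unique cX.1 (principal_filter_proper 1) fx).
move=> V /nbhs_singleton Vx.
by apply/principal_filterP; rewrite /= gact1.
Qed.

Lemma ambit_unit_fixed : fixed_by ambit_unit.
Proof.
move=> h Hh; apply: ambit_family_separating => X f.
move=> Ff; rewrite (ambit_family_equivariant Ff); case: Ff => x [cX Hx ft].
by rewrite (ambit_family_unit cX Hx ft) Hx.
Qed.

(** Each point [a] is the limit of the translates of the unit along the filter [a] itself. *)
Lemma ambit_unit_dense : dense (gorbit ambit_unit).
Proof.
move=> O [a Oa] oO; have [[PF _] _] := svalP a.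
have : (fun g : G => gact g ambit_unit) @ sval a --> a.
  apply: initial_gspace_cvg => X f Ff; rewrite -fmap_comp.
  have [x [cX Hx ft]] := Ff.
  have -> : f \o (fun g : G => gact g ambit_unit) = fun g => gact g x.
    apply: funext => g /=.
    by rewrite (ambit_family_equivariant Ff) (ambit_family_unit cX Hx ft).
  exact: ft.
move=> /(_ O (open_nbhs_nbhs (conj oO Oa))) Oe.
have [g Og] : exists g : G, O (gact g ambit_unit) by exact: (@filter_ex _ _ PF).
by exists (gact g ambit_unit); split=> //; exists g.
Qed.

Lemma ambit_universal (X : gSpaceType G) (x : X) :
  compact_gspace X -> fixed_by x ->
  exists f : ambit -> X,
    [/\ continuous f, equivariant f & f ambit_unit = x].
Proof.
move=> cX Hx; have [f ft] := ambit_family_ex cX Hx.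
have Ff : ambit_family f by exists x.
exists f; split; first exact: initial_gspace_continuous.
- exact: ambit_family_equivariant.
- exact: ambit_family_unit ft.
Qed.

End Ambit.

(** * The Chabauty topology *)

Section Chabauty.
Variable G : topologicalGroupType.

Lemma chabauty_subbase_open (A : set (closed_subgroup G)) :
  @chabauty_subbase G A -> open A.
Proof.
move=> sA; exists [set A]; last by rewrite bigcup_set1.
by move=> _ ->; exact: (finI_from1 id).
Qed.

Lemma chabauty_cvg (F : set_system (closed_subgroup G)) K : Filter F ->
  (forall A, @chabauty_subbase G A -> A K -> F A) -> F --> K.
Proof.
move=> FF sF A; rewrite nbhsE => -[_ [[D sD <-] [B DB BK]] BA].
apply: (@filterS _ F _ B); first by move=> L BL; apply: BA; exists B.
have [E sE EB] := sD B DB; rewrite -EB.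
apply: filter_bigI => C EC; apply: sF; first by have := sE _ EC; rewrite inE.
by move: BK; rewrite -EB; apply.
Qed.

Lemma divg_continuous : continuous (fun p : G * G => p.1 / p.2).
Proof.
move=> [x y].
have cV : (fun p : G * G => p.2^-1) @ (x, y) --> y^-1.
  have := @invg_continuous G y.
  exact: (cvg_comp _ _ (@cvg_snd _ _ (nbhs x) (nbhs y) _)).
exact: (cvg_comp2 (@cvg_fst _ _ (nbhs x) (nbhs y) _) cV
  (@mulg_continuous G (x, y^-1))).
Qed.

(* An ultrafilter U of closed subgroups converges to the set of the h all of
   whose neighbourhoods meet U-almost every subgroup. *)
Lemma chabauty_compact : compact [set: closed_subgroup G].
Proof.
rewrite compact_ultra => U UU _.
pose hit (V : set G) := [set K : closed_subgroup G | K `&` V !=set0].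
pose L : set G := [set h | forall V, nbhs h V -> U (hit V)].
have clL : closed L.
  move=> h clh V /nbhs_interior hV; have [k [Lk]] := clh _ hV.
  exact: Lk.
have grL : group_closed [pred x | x \in L].
  split=> [|x y]; rewrite -!topredE /= !inE.
    move=> V /nbhs_singleton V1; rewrite (_ : hit V = setT).
      exact: filterT.
    apply/seteqP; split=> // K _; exists 1; split => //.
    by have [+ _] := csg_group K; rewrite -topredE /= inE.
  move=> Lx Ly V xyV.
  have [[A B] /= [xA yB] AB] := @divg_continuous (x, y) V xyV.
  apply: filterS (filterI (Lx A xA) (Ly B yB)) => K [[a [Ka Aa]] [b [Kb Bb]]].
  exists (a * b^-1); split; last exact: (AB (a, b)).
  have [_ /(_ a b)] := csg_group K.
  by rewrite -!topredE /= !inE; apply.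
exists (ClosedSubgroup clL grL); split=> //.
apply: chabauty_cvg => _ [[C cC <-]|[V oV <-]] /=.
  move=> LC; move/compact_near_coveringP in cC.
  pose miss (K : closed_subgroup G) c := ~ csg_set K c.
  (* A point outside [L] has a neighbourhood missed by [U]-almost every subgroup, since [U] is
     ultra; compactness of [C] makes this uniform. *)
  have /(cC _ _ miss) : forall c, C c ->
      \forall c' \near c & K \near U, miss K c'.
    move=> c Cc; have : ~ L c by move=> Lc; have : set0 c by rewrite -LC.
    move=> /existsNP[V /not_implyP[cV nV]].
    have [//|UV] := in_ultra_setVsetC (hit V) UU.
    exists (V, ~` hit V) => // -[c' K] [/= Vc' nK] Kc'.
    by apply: nK; exists c'.
  apply: filterS => K KC; apply/seteqP; split=> // k [Kk /KC]; exact.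
move=> [h [Lh Vh]]; apply: (Lh V); exact: open_nbhs_nbhs.
Qed.

(** If h in [K] moves x, separate h x from x: elements near h still move points near x, and the
    subgroups meeting an open set around h form a Chabauty-open set. *)
Lemma closed_fixed (X : gSpaceType G) : hausdorff_space X ->
  closed [set p : closed_subgroup G * X | fixed_by (csg_set p.1) p.2].
Proof.
move=> hX; rewrite -openC openE => -[K x] /=.
move=> /existsNP[h /not_implyP[Kh /eqP hx]].
move: (hX); rewrite open_hausdorff => /(_ _ _ hx) [[A B] /= [Ahx Bx]].
move: Ahx Bx; rewrite !inE => Ahx Bx [oA oB AB].
have : nbhs (gact h x) A by exact: open_nbhs_nbhs.
move=> /(@gact_continuous G X (h, x)) [[V W] /= [hV xW] VW].
exists ([set L : closed_subgroup G | csg_set L `&` V^° !=set0], W `&` B).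
  split=> /=; last by apply: filterI => //; exact: open_nbhs_nbhs.
  apply: open_nbhs_nbhs; split; last by exists h; split.
  apply: chabauty_subbase_open; right.
  by exists V^°; first exact: open_interior.
move=> [L y] /= [[k [Lk /interior_subset Vk]] [Wy By]] /(_ _ Lk) ky.
have : (A `&` B) y by split=> //; rewrite -ky; exact: (VW (k, y)).
by rewrite AB.
Qed.

End Chabauty.

(** * Fixed points of members of a URS *)

Section Subordination.
Variable G : topologicalGroupType.

Lemma fixed_conj (X : gSpaceType G) (K : closed_subgroup G) (x : X) g :
  fixed_by K x -> fixed_by (csg_conj g K) (gact g x).
Proof.
move=> Kx _ [k Kk <-]; by rewrite conjgE invgK !gactM gactK Kx.
Qed.

Lemma closed_has_fixed (X : gSpaceType G) : compact_gspace X ->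
  closed [set K : closed_subgroup G | exists x : X, fixed_by K x].
Proof.
move=> [hX cX].
have -> : [set K : closed_subgroup G | exists x : X, fixed_by K x] =
    [set K | exists2 x, [set: X] x &
      [set p : closed_subgroup G * X | fixed_by p.1 p.2] (K, x)].
  by apply/seteqP; split=> K [x]; exists x.
exact: closed_proj (closed_fixed hX) cX.
Qed.

(** Here the closed set of fixing pairs is projected along [HH], which is compact as a closed subset
    of the Chabauty space. *)
Lemma closed_fixed_by (X : gSpaceType G) (HH : set (closed_subgroup G)) :
  hausdorff_space X -> closed HH ->
  closed [set x : X | exists2 K, HH K & fixed_by K x].
Proof.
move=> hX clHH; have cHH : compact HH.
  exact: subclosed_compact clHH (@chabauty_compact G) _.
apply: (closed_proj
  (E := [set p : X * closed_subgroup G | fixed_by p.2 p.1])) cHH.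
apply: (preimage_closed (f := fun p : X * closed_subgroup G => (p.2, p.1)) _
  (closed_fixed hX)).
by move=> p _; exact: swap_continuous.
Qed.

(** The subgroups with a fixed point in [X] form a closed set containing all conjugates of [K],
    whose closure contains [HH]. *)
Lemma URS_subordinate (X : gSpaceType G) (HH : set (closed_subgroup G)) K
    (x : X) :
  URS HH -> compact_gspace X -> HH K -> fixed_by K x -> subordinate HH X.
Proof.
move=> uHH cX HK Kx L /(urs_minimal uHH HK); move=> clL.
apply: (closed_has_fixed cX); apply: (closureS _ clL) => _ [g _ <-].
by exists (gact g x); exact: fixed_conj.
Qed.

End Subordination.

(** * Coalescence *)

Lemma ellis_numakura (X : topologicalType) (op : X -> X -> X) (A : set X) :
  hausdorff_space X -> compact A -> A !=set0 ->
  (forall x y, A x -> A y -> A (op x y)) ->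
  (forall x y z, A x -> A y -> A z -> op (op x y) z = op x (op y z)) ->
  (forall y, A y -> continuous (op^~ y)) ->
  exists2 v, A v & op v v = v.
Proof.
move=> hX cA A0 opA opC opc.
pose P : set (set X) := [set B | [/\ closed B, B `<=` A &
  forall x y, B x -> B y -> B (op x y)]].
have PA : P A by split=> //; exact: compact_closed.
have Pcap (D : set (set X)) : D !=set0 -> D `<=` P -> P (\bigcap_(B in D) B).
  move=> [B0 DB0] DP; split.
  - by apply: closed_bigI => B /DP[].
  - by move=> x /(_ _ DB0); have [_ + _] := DP _ DB0; apply.
  - by move=> x y Dx Dy B DB; have [_ _] := DP _ DB; apply;
      [exact: Dx|exact: Dy].
have [|B [[clB BA opB] [x Bx] BA' Bmin]] := compact_minimal cA A0 PA _ Pcap.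
  by move=> B [].
have cB : compact B by exact: subclosed_compact clB cA BA.
have Ax := BA _ Bx.
(* B x is a closed subsemigroup of the minimal one [B], so x = b x for some b in [B]. *)
pose C := (op^~ x) @` B.
have CB : C `<=` B by move=> _ [b Bb <-]; exact: opB.
have [||b Bb bx] := Bmin C _ _ CB x Bx.
- split; last 1 first.
  + move=> _ _ [b Bb <-] [c Bc <-]; exists (op (op b x) c).
      by apply: (opB) => //; exact: opB.
    by rewrite opC//; apply: BA => //; exact: opB.
  + apply: compact_closed => //; apply: continuous_compact => //.
    exact/continuous_subspaceT/opc.
  + exact: subset_trans CB BA.
- by exists (op x x), x.
(* This closed subsemigroup contains that b; by minimality it contains x, which is thus
   idempotent. *)
pose S := B `&` [set c | op c x = x].
have [|||_ xx] := Bmin S _ _ _ x Bx; last by exists x.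
- split; last 1 first.
  + move=> c d [Bc cx] [Bd dx]; split; first exact: opB.
    by rewrite /= opC//; [rewrite dx|exact: BA|exact: BA].
  + apply: closedI => //; apply: closed_equalizer => //; first exact: opc.
    by move=> y; exact: cvg_cst.
  + by move=> c [/BA].
- by exists b.
- by move=> c [].
Qed.

Section Coalescence.
Variable G : topologicalGroupType.

Definition gmorphism (X Y : gSpaceType G) (f : X -> Y) :=
  continuous f /\ equivariant f.

Lemma gmorphism_comp (X Y Z : gSpaceType G) (f : X -> Y) (f' : Y -> Z) :
  gmorphism f -> gmorphism f' -> gmorphism (f' \o f).
Proof.
move=> [cf ef] [cf' ef']; split; last by move=> g x /=; rewrite ef ef'.
by move=> x; apply: continuous_comp; [exact: cf|exact: cf'].
Qed.

Lemma gmorphism_fixed (H : set G) (X Y : gSpaceType G) (f : X -> Y) (x : X) :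
  gmorphism f -> fixed_by H x -> fixed_by H (f x).
Proof. by move=> [_ ef] Hx h Hh; rewrite -ef Hx. Qed.

Lemma closed_fixed_points (H : set G) (X : gSpaceType G) :
  hausdorff_space X -> closed [set x : X | fixed_by H x].
Proof.
move=> hX; rewrite (_ : mkset _ = \bigcap_(h in H) [set x | gact h x = x]).
  apply: closed_bigI => h _; apply: closed_equalizer => //.
    exact: gact_continuousr.
  by move=> y; exact: cvg_id.
by [].
Qed.

Variables (H : set G) (A M : gSpaceType G) (e : A) (i : M -> A).
Hypothesis dense_e : dense (gorbit e).
Hypothesis A_univ : forall m : M, fixed_by H m ->
  exists f : A -> M, gmorphism f /\ f e = m.
Hypothesis cM : compact_gspace M.
Hypothesis minM : minimal_gspace M.
Hypothesis morph_i : gmorphism i.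
Hypothesis fixM : exists m : M, fixed_by H m.

(* For fixed points x and y, let x y = f_y (i x), where f_y : A -> M maps e to
   y; this is a semigroup law, the image of phi is a subsemigroup, and an
   idempotent phi x satisfies f_(phi x) o i = id, by minimality of M. *)
Lemma endomorphism_section (phi : M -> M) : gmorphism phi ->
  exists sigma : M -> M, gmorphism sigma /\ cancel sigma phi.
Proof.
move=> mphi; have hM := cM.1.
have [rho rhoP] : exists rho : M -> A -> M,
    forall m, fixed_by H m -> gmorphism (rho m) /\ rho m e = m.
  suff /choice[rho rhoP] : forall m : M, exists f : A -> M,
    fixed_by H m -> gmorphism f /\ f e = m by exists rho.
  move=> m; have [/A_univ[f fP]|nHm] := pselect (fixed_by H m).
    by exists f.
  by exists (fun=> m).
have rho_eq m (f : A -> M) :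
    fixed_by H m -> gmorphism f -> f e = m -> rho m = f.
  move=> Hm [cf ef] fm; have [[cr er] rm] := rhoP m Hm.
  by apply: (equivariant_ext hM dense_e) => //; rewrite rm.
pose op x y := rho y (i x).
pose F := [set m : M | fixed_by H m].
have opF x y : F x -> F y -> F (op x y).
  move=> Fx Fy; apply: (gmorphism_fixed (f := rho y)).
    exact: (rhoP y Fy).1.
  exact: gmorphism_fixed.
have cF : compact F.
  exact: (subclosed_compact (closed_fixed_points (H := H) hM) cM.2).
have phiF x : F x -> F (phi x) by exact: gmorphism_fixed.
have rho_phi y : F y -> rho (phi y) = phi \o rho y.
  move=> Fy; have [my ye] := rhoP y Fy; apply: rho_eq; first exact: phiF.
    exact: gmorphism_comp.
  by rewrite /= ye.
have rho_op y z : F y -> F z -> rho (op y z) = rho z \o (i \o rho y).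
  move=> Fy Fz; have [my ye] := rhoP y Fy; have [mz ze] := rhoP z Fz.
  apply: rho_eq; first exact: opF.
    by do 2!apply: gmorphism_comp => //.
  by rewrite /= ye.
have [|||||v [x Fx <-] xx] := @ellis_numakura M op (phi @` F) hM.
- apply: continuous_compact => //; exact/continuous_subspaceT/mphi.1.
- by have [m Fm] := fixM; exists (phi m), m.
(* (phi x)(phi y) = phi((phi x) y), because f_(phi y) = phi o f_y. *)
- move=> _ _ [x Fx <-] [y Fy <-]; exists (op (phi x) y).
    by apply: opF => //; exact: phiF.
  by rewrite /op rho_phi.
- move=> _ _ _ [x Fx <-] [y Fy <-] [z Fz <-].
  by rewrite {3}/op rho_op//; exact: phiF.
- move=> _ [y Fy <-]; rewrite /op.
  exact: (gmorphism_comp morph_i (rhoP _ (phiF _ Fy)).1).1.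
have [mx xe] := rhoP x Fx.
have mxi : gmorphism (rho x \o i) by exact: gmorphism_comp.
exists (rho x \o i); split=> //.
have mid : gmorphism (@id M) by split=> // y; exact: cvg_id.
have [cs es] := gmorphism_comp mxi mphi.
suff E : phi \o (rho x \o i) = id by move=> m; exact: (congr1 (@^~ m) E).
apply: (equivariant_ext hM (minM.2 (phi x)) cs mid.1 es mid.2).
by move: xx; rewrite /op rho_phi.
Qed.

(** A section [s] of [phi] has itself a section [t]; then t = phi s t = phi, so [s] is a two-sided
    inverse. *)
Lemma endomorphism_inverse (phi : M -> M) : gmorphism phi ->
  exists sigma : M -> M,
    [/\ gmorphism sigma, cancel sigma phi & cancel phi sigma].
Proof.
move=> /endomorphism_section[s [ms sK]].
have [t [_ tK]] := endomorphism_section ms.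
exists s; split=> // m; rewrite -{1}[m]tK sK; exact: tK.
Qed.

End Coalescence.

(** * Minimal subspaces and the universal minimal subordinate space *)

Lemma minimal_sub_gspace (G : topologicalGroupType) (X : gSpaceType G) :
  compact_gspace X -> [set: X] !=set0 ->
  exists (M : gSpaceType G) (i : M -> X),
    [/\ compact_gspace M, minimal_gspace M, gmorphism i & injective i].
Proof.
move=> cX X0.
pose P := [set B : set X | closed B /\ ginvariant B].
have [|||M0 [[clM0 iM0] [x0 M0x] _ M0min]] := @compact_minimal X P setT cX.2 X0.
- by split=> //; exact: closedT.
- by move=> B [].
- move=> D _ DP; split; first by apply: closed_bigI => B /DP[].
  by move=> g x Dx B DB; have [_ iB] := DP _ DB; apply: iB; exact: Dx.
have [M [i [cM ci ei inj_i rangei]]] := sub_gspace cX clM0 iM0.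
exists M, i; split=> //; apply: minimal_gspaceP.
  by move: M0x; rewrite -rangei => -[m _ _]; exists m.
move=> C clC iC [c Cc]; apply/seteqP; split=> // m _.
(* The image of [C] is a nonempty closed invariant subset of [M0], hence all of it; injectivity of
   [i] carries this back to [C]. *)
have [||||c' Cc' /inj_i <- //] := M0min (i @` C) _ _ _ (i m).
- split; first exact: compact_gspace_image_closed ci clC.
  exact: invariant_image.
- by exists (i c), c.
- by rewrite -rangei => _ [c' _ <-]; exists c'.
- by rewrite -rangei; exists m.
Qed.

Theorem theorem1p3 (G : topologicalGroupType) (hausG : hausdorff_space G)
    (lcG : locally_compact [set: G])
    (HH : set (closed_subgroup G)) (ursHH : URS HH) :
  exists M : gSpaceType G,
    universal (minimal_subordinate HH) M /\
    forall M' : gSpaceType G,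
      universal (minimal_subordinate HH) M' -> gspace_iso M M'.
Proof.
have [K HK] := urs_neq0 ursHH.
pose A : gSpaceType G := ambit K.
pose e : A := ambit_unit K.
have de : dense (gorbit e) := @ambit_unit_dense G K.
have cA : compact_gspace A.
  by split; [exact: ambit_hausdorff|exact: ambit_compact].
have [|M [i [cM mM mi inj_i]]] := minimal_sub_gspace cA; first by exists e.
have [m0 _] := mM.1.
have sM : subordinate HH M.
  have [L HL Lm] : exists2 L, HH L & fixed_by L (i m0).
    have clF := closed_fixed_by cA.1 (urs_closed ursHH).
    (* Being fixed by a member of [HH] is a closed condition. It holds on the dense orbit of [e],
       whose points are fixed by conjugates of [K]. *)
    suff /(dense_closed de clF)/seteqP[_] :
        gorbit e `<=` [set a | exists2 L, HH L & fixed_by (csg_set L) a].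
      by apply.
    move=> _ [g _ <-]; exists (csg_conj g K); first exact: urs_conj.
    exact/fixed_conj/ambit_unit_fixed.
  apply: (URS_subordinate ursHH cM HL (x := m0)) => h Lh.
  by apply: inj_i; rewrite mi.2 Lm.
have A_univ (X : gSpaceType G) (x : X) : compact_gspace X -> fixed_by K x ->
    exists f : A -> X, gmorphism f /\ f e = x.
  by move=> cX Kx; have [f [cf ef fe]] := ambit_universal cX Kx; exists f.
have uM : universal (minimal_subordinate HH) M.
  split=> // Y [cY mY /(_ K HK)[y Ky]]; have [f [mf _]] := A_univ Y y cY Ky.
  have [cfi efi] := gmorphism_comp mi mf.
  exists (f \o i); split=> //; apply: equivariant_surj => //; exact: mM.1.
exists M; split=> // M' [mM' uM'].
have [f [cf sf ef]] := uM.2 M' mM'.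
have [f' [cf' _ ef']] := uM' M uM.1.
have [] := @endomorphism_inverse G K A M e i de _ cM mM mi (sM K HK) (f' \o f).
- by move=> m; exact: A_univ.
- by apply: gmorphism_comp.
(* As [s] inverts [f' \o f], the map [s \o f'] is a left inverse of [f]; surjectivity of [f] makes
   it two-sided. *)
move=> s [[cs es] _ /= sK]; exists f, (s \o f').
have [cs' es'] := gmorphism_comp (conj cf' ef') (conj cs es).
split=> // y; have [x _ <-] := sf y I.
by congr f; exact: sK.
Qed.
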